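(* Let $d\ge1$ and $s\ge d+1$. Let $\Phi$ be a non-increasing function tending to zero at infinity such that $$\liminf_{T\to\infty}\frac{\Phi(2T)}{\Phi(T)}>0\qquad\text{and}\qquad\sum_{m=1}^\infty 2^{md(s+1)}\Phi(2^m)^{s-d}<\infty.$$ Then, with respect to $(d\times s)$-dimensional Lebesgue measure, for almost every $\bm{\Theta}=(\bm{\theta}_1,\dots,\bm{\theta}_s)\in(\mathbb{R}^d)^s$ there is $c=c(\bm{\Theta})>0$ such that $\bm{\Theta}\in UDT_s^d(c\Phi)$.
   Context: Let $\langle x\rangle$ denote the distance from $x\in\mathbb{R}$ to $\mathbb{Z}$. For a non-increasing function $\Psi$ tending to zero at infinity, an $s$-tuple $\bm{\Theta}=(\bm{\theta}_1,\dots,\bm{\theta}_s)$ of vectors in $\mathbb{R}^d$ belongs to $UDT_s^d(\Psi)$ (uniformly Diophantine of type $\Psi$) if for every real $T\ge1$ and every $\bm{\xi}\in\mathbb{R}^d$ there is $i\in\{1,\dots,s\}$ such that for all $\bm{u}\in\mathbb{Z}^d\setminus\{\bm{0}\}$ with $\|\bm{u}\|_\infty\le T$, $\langle\bm{u}\cdot(\bm{\xi}-\bm{\theta}_i)\rangle\ge\Psi(T)$. *)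

(* Defs.v *)
From HB Require Import structures.
From mathcomp Require Import all_boot all_order all_algebra.
From mathcomp Require Import all_classical all_reals all_analysis.

Set Implicit Arguments.
Unset Strict Implicit.
Unset Printing Implicit Defensive.

Import Order.TTheory GRing.Theory Num.Theory.
Import numFieldNormedType.Exports.

Local Open Scope classical_set_scope.
Local Open Scope ring_scope.

Section power_measure.
Context (disp : measure_display) (T : measurableType disp) (R : realType).
Local Open Scope ereal_scope.

Definition tcons n (x : T * n.-tuple T) : n.+1.-tuple T := cons_tuple x.1 x.2.

Lemma measurable_tcons n : measurable_fun [set: T * n.-tuple T] (@tcons n).
Proof. exact: (measurable_cons measurable_fst measurable_snd). Qed.

Lemma tnth_tcons0 n (x : T * n.-tuple T) : tnth (tcons x) ord0 = x.1.
Proof. by rewrite (tnth_nth x.1). Qed.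

Lemma tnth_tconsS n (x : T * n.-tuple T) i :
  tnth (tcons x) (lift ord0 i) = tnth x.2 i.
Proof. by rewrite !(tnth_nth x.1). Qed.

Variable mu : {sigma_finite_measure set T -> \bar R}.

(* mu \x nu, a measure on T * n.-tuple T, carried over to n.+1.-tuple T. *)
Definition cons_measure n (nu : {sigma_finite_measure set (n.-tuple T) -> \bar R})
  : set (n.+1.-tuple T) -> \bar R := pushforward (mu \x nu) (@tcons n).

Section cons_measure.
Variables (n : nat) (nu : {sigma_finite_measure set (n.-tuple T) -> \bar R}).

Let mtcons (A : set (n.+1.-tuple T)) :
  measurable A -> measurable (@tcons n @^-1` A).
Proof. by move=> mA; rewrite -[X in measurable X]setTI; exact: measurable_tcons. Qed.

Let cons_measure0 : cons_measure nu set0 = 0.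
Proof. by rewrite /cons_measure /pushforward preimage_set0 measure0. Qed.

Let cons_measure_ge0 A : 0 <= cons_measure nu A.
Proof. exact: (measure_ge0 (mu \x nu)). Qed.

Let cons_measure_sigma_additive : semi_sigma_additive (cons_measure nu).
Proof.
move=> F mF tF mUF; rewrite /cons_measure /pushforward preimage_bigcup.
apply: measure_semi_sigma_additive.
- by move=> k; exact: mtcons.
- apply/trivIsetP => /= i j _ _ ij; rewrite -preimage_setI.
  by move/trivIsetP : tF => /(_ _ _ _ _ ij) ->//; rewrite preimage_set0.
- by rewrite -preimage_bigcup; exact: mtcons.
Qed.

HB.instance Definition _ := isMeasure.Build _ _ _ (cons_measure nu)
  cons_measure0 cons_measure_ge0 cons_measure_sigma_additive.

Let cons_measure_sigma_finite : sigma_finite setT (cons_measure nu).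
Proof.
have /sigma_finiteP[F [TF ndF Foo]] := sigma_finiteT mu.
have /sigma_finiteP[G [TG ndG Goo]] := sigma_finiteT nu.
pose uncons (t : n.+1.-tuple T) : T * n.-tuple T := (thead t, [tuple of behead t]).
have unconsK : uncons \o @tcons n = id.
  by apply/funext => -[x t]; congr pair => //; exact/val_inj.
have muncons : measurable_fun setT uncons.
  apply: measurable_fun_pair; first exact: measurable_tnth.
  exact: measurable_behead.
exists (fun k => uncons @^-1` (F k `*` G k)).
  rewrite -preimage_bigcup -(preimage_setT uncons); congr (_ @^-1` _).
  rewrite -setXTT TF TG predeqE => -[x y]; split.
    move=> [/= [k _ Fkx] [l _ Gly]]; exists (maxn k l) => //; split.
    - by move: x Fkx; exact/subsetPset/ndF/leq_maxl.
    - by move: y Gly; exact/subsetPset/ndG/leq_maxr.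
  by move=> [k _ []/= ? ?]; split; exists k.
move=> k; have [mFk Fkoo] := Foo k; have [mGk Gkoo] := Goo k; split.
  by rewrite -[X in measurable X]setTI; apply: muncons => //; exact: measurableX.
rewrite /cons_measure /pushforward -comp_preimage unconsK preimage_id.
by rewrite product_measure1E// lte_mul_pinfty// ge0_fin_numE.
Qed.

HB.instance Definition _ := Measure_isSigmaFinite.Build _ _ _ (cons_measure nu)
  cons_measure_sigma_finite.

End cons_measure.

Fixpoint power_measure n : {sigma_finite_measure set (n.-tuple T) -> \bar R} :=
  match n with
  | 0 => \d_([tuple] : 0.-tuple T)
  | m.+1 => cons_measure (power_measure m)
  end.

Lemma power_measure_box n (A : 'I_n -> set T) : (forall i, measurable (A i)) ->
  power_measure n [set t | forall i, A i (tnth t i)] = \prod_(i < n) mu (A i).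
Proof.
elim: n A => [|n IHn] A mA.
  rewrite big_ord0 [LHS]diracE mem_set//=; first by case.
rewrite big_ord_recl -(IHn (fun i => A (lift ord0 i)))//.
rewrite -product_measure1E//; last first.
  have -> : [set t : n.-tuple T | forall i, A (lift ord0 i) (tnth t i)] =
      \bigcap_(i in [set: 'I_n]) ((@tnth n T)^~ i @^-1` A (lift ord0 i)).
    by apply/seteqP; split => [t h i _|t h i]; [exact: h|exact: (h i)].
  apply: fin_bigcap_measurable => // i _.
  by rewrite -[X in measurable X]setTI; exact: measurable_tnth.
apply: (congr1 (mu \x power_measure n)); apply/seteqP; split => [x /= h|x /= [h0 h] i].
  split; first by have := h ord0; rewrite tnth_tcons0.
  by move=> i; have := h (lift ord0 i); rewrite tnth_tconsS.
by case: (unliftP ord0 i) => [j|] ->; rewrite ?tnth_tconsS ?tnth_tcons0.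
Qed.

End power_measure.

Section uniformly_diophantine.
Context {R : realType}.

(* The ds-dimensional Lebesgue measure on (R^d)^s, as a product of
   one-dimensional ones. *)
Definition lebesgue_measure_pow (s d : nat) :
    {sigma_finite_measure set (s.-tuple (d.-tuple (measurableTypeR R))) -> \bar R} :=
  power_measure (power_measure (@lebesgue_measure R) d) s.

Definition dist_int (x : R) : R := inf [set `|x - m%:~R| | m in [set: int]].

Definition dot_int (d : nat) (u : 'rV[int]_d) (x : 'I_d -> R) : R :=
  \sum_(j < d) (u ord0 j)%:~R * x j.

(* The norm of a matrix is the maximum of the absolute values of its entries. *)
Definition UDT (s d : nat) (Psi : R -> R) : set (s.-tuple (d.-tuple R)) :=
  [set Theta | forall (T : R) (xi : d.-tuple R), 1 <= T ->
    exists i : 'I_s, forall u : 'rV[int]_d, u != 0 ->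
      `|map_mx intr u : 'rV[R]_d| <= T ->
      Psi T <= dist_int (dot_int u (fun j => tnth xi j - tnth (tnth Theta i) j))].

End uniformly_diophantine.

Arguments lebesgue_measure_pow R s d : clear implicits.
Arguments UDT {R} s d Psi.

(* Main.v *)
(** Fix [N] and restrict [Theta] to the cube of side [2N]; put [psi = Phi (2 ^ m)].
If [Theta] fails the condition at the scale [T = 2 ^ m], some [xi] has, for each
[i], a nonzero [u_i] of norm at most [T] with [u_i . (xi - theta_i)] within
[psi] of an integer.  Modulo 1 one may move [xi] to a point [g / K] of a grid in
the unit cube with [K ~ d T / psi], losing a factor 2 in [psi].  For fixed [u_i]
and [g] each [theta_i] then lies in a periodic union of slabs of measure
[O(psi)].  There are [O(T^(d s))] choices of the [u_i] and [O((T / psi)^d)] of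
[g], so the exceptional set at scale [2 ^ m] has measure
[O(T^(d (s + 1)) psi^(s - d))].  Borel-Cantelli leaves finitely many bad scales
for almost every [Theta], and the doubling condition on [Phi] interpolates
between consecutive powers of 2. *)

Require Import Defs.
From mathcomp Require Import all_boot all_order all_algebra.
From mathcomp Require Import all_classical all_reals all_analysis.
From mathcomp Require Import measurable_realfun zify lra.

Import Order.TTheory GRing.Theory Num.Theory.
Import numFieldNormedType.Exports.

Local Open Scope classical_set_scope.
Local Open Scope ring_scope.

(** * Measure of finite unions and of sets with small sections *)

Lemma measure_bigcup_finType_le {disp} {T : measurableType disp} {R : realType}
    (mu : {measure set T -> \bar R}) (I : finType) (F : I -> set T) (c : R) :
  (forall i, measurable (F i)) -> (forall i, (mu (F i) <= c%:E)%E) ->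
  (mu (\bigcup_i F i) <= (#|I|%:R * c)%:E)%E.
Proof.
move=> mF Fc.
have -> : \bigcup_i F i = \big[setU/set0]_(i <- enum I) F i.
  rewrite -bigcup_seq; apply: eq_bigcupl; split=> // i _ /=.
  by rewrite mem_enum.
rewrite cardE; elim: (enum I) => [|i r IHr].
  by rewrite big_nil measure0 /= mul0r.
rewrite big_cons; apply: le_trans (measureU2 _ _ _) _ => //.
  exact: bigsetU_measurable.
by rewrite /= -[in leRHS]natr1 mulrDl mul1r addrC EFinD leeD.
Qed.

Lemma product_measure_le_ysection {d1 d2} {T1 : measurableType d1}
    {T2 : measurableType d2} {R : realType}
    (m1 : {sigma_finite_measure set T1 -> \bar R})
    (m2 : {sigma_finite_measure set T2 -> \bar R})
    (X : set (T1 * T2)) (B : set T2) (c : R) :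
  measurable X -> measurable B -> 0 <= c ->
  (forall y, B y -> (m1 (ysection X y) <= c%:E)%E) ->
  (forall y, ~ B y -> ysection X y = set0) ->
  ((m1 \x m2) X <= c%:E * m2 B)%E.
Proof.
move=> mX mB c0 Xc X0.
(* [\x] integrates over the first factor; by uniqueness the product measure can also be computed by
   integrating the measures of the [y]-sections. *)
rewrite (@product_measure_unique _ _ _ _ _ _ _ (m1 \x^ m2)%E)//; last first.
  by move=> A1 A2 mA1 mA2; exact: product_measure2E.
rewrite -integral_cst// [leRHS]integral_mkcond; apply: ge0_le_integral => //.
- exact: measurable_fun_ysection.
- by apply/(measurable_restrictT _ _).1 => //; exact: measurable_cst.
- move=> y _ /=; rewrite patchE; case: ifPn => [|/negP]; rewrite inE.
    exact: Xc.
  by move=> /X0 ->; rewrite measure0.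
Qed.

(** * Volume of periodic slabs in a cube *)

Section slab.
Context {R : realType}.
Implicit Types (N D a delta : R) (d : nat).
Local Notation leb := (@lebesgue_measure R).

Definition near_int a delta : set R :=
  \bigcup_(p : int) `]a + p%:~R - delta, a + p%:~R + delta[%classic.

Definition cube d N : set (d.-tuple (measurableTypeR R)) :=
  [set t | forall i, `[- N, N]%classic (tnth t i)].

Definition slab d (u : 'I_d -> int) a delta N
    : set (d.-tuple (measurableTypeR R)) :=
  cube d N `&` [set t | near_int a delta (\sum_i (u i)%:~R * tnth t i)].

Lemma near_intP a delta x :
  near_int a delta x <-> exists p : int, `|x - a - p%:~R| < delta.
Proof.
split=> [[p _ /=]|[p]].
  by rewrite in_itv /= => /andP[? ?]; exists p; rewrite ltr_norml; lra.
by rewrite ltr_norml => h; exists p => //=; rewrite in_itv /=; lra.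
Qed.

Lemma measurable_near_int a delta :
  measurable (near_int a delta : set (measurableTypeR R)).
Proof. by apply: open_measurable; apply: bigcup_open => p _; exact: interval_open. Qed.

Lemma measurable_cube d N : measurable (cube d N).
Proof.
have -> : cube d N =
    \bigcap_(i in [set: 'I_d]) ((fun t => tnth t i) @^-1` `[- N, N]).
  by apply/seteqP; split => [t h i _|t h i]; [exact: h|exact: (h i)].
apply: fin_bigcap_measurable => // i _.
by rewrite -[X in measurable X]setTI; exact: measurable_tnth.
Qed.

Lemma measurable_slab d u a delta N : measurable (@slab d u a delta N).
Proof.
apply: measurableI; first exact: measurable_cube.
have mf : measurable_fun setT
    (fun t : d.-tuple (measurableTypeR R) => \sum_i (u i)%:~R * tnth t i : measurableTypeR R).
  by apply: measurable_sum => i; apply: measurable_funM => //; exact: measurable_tnth.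
by rewrite -[X in measurable X]setTI; apply: mf => //; exact: measurable_near_int.
Qed.

Lemma lebesgue_symmetric_itv N : 0 <= N ->
  leb `[- N, N]%classic = (N *+ 2)%:E.
Proof.
move=> N0; rewrite lebesgue_measure_itv /= lte_fin.
by case: ltrP => h; congr (_%:E); lra.
Qed.

Lemma cube_measure d N : 0 <= N ->
  power_measure leb d (cube d N) = ((N *+ 2) ^+ d)%:E.
Proof.
move=> N0; rewrite (@power_measure_box _ _ _ leb _ (fun=> `[- N, N]%classic))//.
rewrite (eq_bigr (fun=> (N *+ 2)%:E)) => [|i _].
  by rewrite prodEFin prodr_const card_ord.
exact: lebesgue_symmetric_itv.
Qed.

(** The solutions lie in intervals of length [2 * delta / |v|], and [O(|v|)] of these meet
    [[- N, N]], so the bound is uniform in [v]. The set [A] will be a section of a slab. *)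
Lemma lebesgue_near_int_le N D (v : int) a delta (A : set (measurableTypeR R)) :
  0 <= N -> v != 0 -> 0 < delta -> delta <= D -> measurable A ->
  A `<=` `[- N, N] -> (forall x, A x -> near_int a delta (v%:~R * x)) ->
  (leb A <= (4 * (N + D + 1) * delta)%:E)%E.
Proof.
move=> N0 v0 d0 dD mA AN Av.
pose w := `|v%:~R| : R.
have w1 : 1 <= w by rewrite /w -intr_norm -[1]/(1%:~R) ler_int -gtz0_ge1 normr_gt0.
have w0 : 0 < w by lra.
have vr0 : v%:~R != 0 :> R by rewrite intr_eq0.
(* The relevant integers lie in an interval of length [2 * (w * N + delta)]; one extra unit pays for
   rounding its lower end down to [p0], the other for [truncn]. *)
pose L := (Num.truncn (2 * (w * N + delta))).+2.
pose p0 : int := Num.floor (- (w * N) - a - delta).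
pose F (k : 'I_L) : set (measurableTypeR R) :=
  `](a + p0%:~R + k%:R) / v%:~R - delta / w, (a + p0%:~R + k%:R) / v%:~R + delta / w[%classic.
have mF k : measurable (F k) by exact: measurable_itv.
have dw0 : 0 < delta / w by rewrite divr_gt0.
have Fk k : (leb (F k) <= (2 * (delta / w))%:E)%E.
  rewrite lebesgue_measure_itv /= lte_fin ifT; last by lra.
  by rewrite -EFinB lee_fin; lra.
have AF : A `<=` \bigcup_k F k.
  move=> x Ax; have /near_intP[p] := Av _ Ax; rewrite ltr_norml => hp.
  have := AN _ Ax; rewrite /= in_itv /= => hx.
  have hvx : `|v%:~R * x| <= w * N.
    by rewrite normrM ler_wpM2l ?ler_norml// ltW.
  move: hvx; rewrite ler_norml => hvx.
  have := floor_le (- (w * N) - a - delta).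
  have := floorD1_gt (- (w * N) - a - delta); rewrite -/p0 intrD => h1 h2.
  have pp0 : 0 <= p - p0.
    by rewrite subr_ge0 -ltzD1 -(ltr_int R) intrD; lra.
  have hk : `|p - p0|%:R = p%:~R - p0%:~R :> R.
    by rewrite -[LHS]/((`|p - p0|%N)%:~R) abszE ger0_norm// intrB.
  have kL : (`|p - p0| < L)%N.
    rewrite -(ltr_nat R) hk /L -[X in _ < X]natr1.
    have := truncnS_gt (2 * (w * N + delta)); rewrite -natr1. lra.
  exists (Ordinal kL) => //; apply/andP; rewrite !bnd_simp /= hk; apply/andP.
  have -> : a + p0%:~R + (p%:~R - p0%:~R) = a + p%:~R :> R by lra.
  have : `|x - (a + p%:~R) / v%:~R| < delta / w.
    rewrite ltr_pdivlMr// /w -normrM mulrBl divfK// mulrC opprD addrA.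
    by rewrite ltr_norml.
  by rewrite ltr_norml => h; lra.
apply: le_trans (le_measure _ _ _ AF) _; rewrite ?inE//.
  exact: fin_bigcup_measurable.
apply: le_trans (measure_bigcup_finType_le _ _ _ _ mF Fk) _.
rewrite lee_fin card_ord.
have hL : L%:R <= 2 * (w * N + delta) + 2.
  rewrite /L -natr1 -natr1.
  have h0 : 0 <= 2 * (w * N + delta) by nra.
  by have := truncn_le (2 * (w * N + delta)); rewrite h0 => /idP; lra.
(* As [w >= 1], the additive constants are absorbed into a multiple of [w], which then cancels the
   [1 / w] in the interval lengths. *)
have {}hL : L%:R <= (2 * (N + D + 1)) * w by nra.
have -> : L%:R * (2 * (delta / w)) = (L%:R / w) * (2 * delta) by lra.
have -> : 4 * (N + D + 1) * delta = 2 * (N + D + 1) * (2 * delta) by lra.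
by rewrite ler_wpM2r ?ler_pdivrMr//; lra.
Qed.

(** Induction that peels off the first coordinate: if [u ord0 = 0] the slab is a product with an
    interval; otherwise its sections along that coordinate obey the one-dimensional bound. Neither
    bound sees [u] or [a], so [C] can be chosen before them. *)
Lemma slab_measure_le d N D : 0 <= N -> 0 <= D ->
  exists2 C : R, 0 <= C & forall (u : 'I_d -> int) a delta,
    (exists i, u i != 0) -> 0 < delta -> delta <= D ->
    (power_measure leb d (slab d u a delta N) <= (C * delta)%:E)%E.
Proof.
move=> N0 D0; elim: d => [|d [C C0 IH]].
  by exists 0 => // u a delta [[]].
(* The first summand serves the case [u ord0 != 0], the second the case [u ord0 = 0]. *)
exists (4 * (N + D + 1) * (N *+ 2) ^+ d + N *+ 2 * C).
  by rewrite addr_ge0 ?mulr_ge0 ?exprn_ge0 ?mulrn_wge0//; lra.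
move=> u a delta u0 d0 dD.
pose X := @tcons _ (measurableTypeR R) d @^-1` slab d.+1 u a delta N.
have -> : power_measure leb d.+1 (slab d.+1 u a delta N) =
  (leb \x power_measure leb d)%E X by [].
have mX : measurable X.
  rewrite /X -[X in measurable X]setTI; apply: measurable_tcons => //.
  exact: measurable_slab.
have XE x t : X (x, t) <-> [/\ `[- N, N]%classic x, cube d N t &
    near_int a delta ((u ord0)%:~R * x + \sum_i (u (lift ord0 i))%:~R * tnth t i)].
  rewrite /X /slab /cube /= big_ord_recl tnth_tcons0.
  under [X in _ + X]eq_bigr do rewrite tnth_tconsS.
  split=> [[h ?]|[h1 h2 ?]]; split => //.
  - by have := h ord0; rewrite tnth_tcons0.
  - by move=> i; have := h (lift ord0 i); rewrite tnth_tconsS.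
  - by move=> i; case: (unliftP ord0 i) => [j|] ->; rewrite ?tnth_tconsS ?tnth_tcons0.
have N2 : 0 <= N *+ 2 by exact: mulrn_wge0.
have [u00|u00] := eqVneq (u ord0) 0.
  have -> : X = `[- N, N]%classic `*` slab d (fun i => u (lift ord0 i)) a delta N.
    apply/seteqP; split=> -[x t] /=; rewrite XE u00 mul0r add0r; first by case.
    by case=> ? [].
  rewrite product_measure1E//; last exact: measurable_slab.
  have itvN : (leb `[(- N)%R, N]%classic <= (N *+ 2)%:E)%E by rewrite lebesgue_symmetric_itv.
  have [i ui] : exists i, u (lift ord0 i) != 0.
    case: u0 => i; case: (unliftP ord0 i) => [j|] ->; first by exists j.
    by rewrite u00 eqxx.
  apply: (@le_trans _ _ ((N *+ 2)%R%:E * (C * delta)%R%:E)%E).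
    by apply: lee_pmul => //; last by apply: IH => //; exists i.
  rewrite -EFinM lee_fin.
  have : 0 <= 4 * (N + D + 1) * (N *+ 2) ^+ d * delta.
    by rewrite !mulr_ge0 ?exprn_ge0//; lra.
  by lra.
apply: (le_trans (product_measure_le_ysection _ _ _ (cube d N)
  (4 * (N + D + 1) * delta) _ _ _ _ _)) => //.
- exact: measurable_cube.
- by rewrite !mulr_ge0//; lra.
- move=> t _; apply: (@lebesgue_near_int_le N D (u ord0)
    (a - \sum_i (u (lift ord0 i))%:~R * tnth t i)) => //.
  + exact: measurable_ysection.
  + by move=> x; rewrite /ysection /= inE XE => -[].
  + move=> x; rewrite /ysection /= inE XE => -[_ _ /near_intP[p]].
    by rewrite ltr_norml => h; apply/near_intP; exists p; rewrite ltr_norml; lra.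
- move=> t nt; apply/seteqP; split=> // x; rewrite /ysection /= inE XE.
  by case.
apply: (@le_trans _ _ ((4 * (N + D + 1) * delta)%R%:E * ((N *+ 2) ^+ d)%R%:E)%E).
  by rewrite -cube_measure.
rewrite -EFinM lee_fin.
have : 0 <= N *+ 2 * C * delta by rewrite !mulr_ge0//; lra.
by lra.
Qed.

End slab.

(** * Finite cover of the exceptional set at one scale *)

Section cover.
Context {R : realType}.
Variables (s d Q K : nat) (N psi : R).
Local Notation lebd := (power_measure (@lebesgue_measure R) d).

Definition shifted (k : 'I_(Q + Q).+1) : int := k%:Z - Q%:Z.

(* [x.1 i j] encodes the j-th entry of [u_i], shifted by [Q] into [0, 2Q];
   [x.2] is the numerator [g] of the grid point [g / K]. *)
Definition cover_index : finType :=
  ({ffun 'I_s -> {ffun 'I_d -> 'I_(Q + Q).+1}} * {ffun 'I_d -> 'I_K})%type.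

(** The half-width is [2 * psi]: one [psi] for the failure of the Diophantine condition, one for
    rounding [xi] to the grid. *)
Definition cover_slab (x : cover_index) (i : 'I_s)
    : set (d.-tuple (measurableTypeR R)) :=
  slab d (fun j => shifted (x.1 i j))
    (\sum_j (shifted (x.1 i j))%:~R * ((x.2 j)%:R / K%:R)) (2 * psi) N.

(** An index with some [u_i = 0] gets the empty set: the slab of a zero vector may be the whole
    cube, which would break the measure bound. *)
Definition cover_box (x : cover_index)
    : set (s.-tuple (d.-tuple (measurableTypeR R))) :=
  if [forall i, exists j, shifted (x.1 i j) != 0]
  then [set Theta | forall i, cover_slab x i (tnth Theta i)] else set0.

Definition bad_cover : set (s.-tuple (d.-tuple (measurableTypeR R))) :=
  \bigcup_x cover_box x.

Lemma measurable_cover_box x : measurable (cover_box x).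
Proof.
rewrite /cover_box; case: ifP => // _.
have -> : [set Theta | forall i, cover_slab x i (tnth Theta i)] =
    \bigcap_(i in [set: 'I_s])
      ((fun t : s.-tuple (d.-tuple (measurableTypeR R)) => tnth t i) @^-1` cover_slab x i).
  by apply/seteqP; split => [t h i _|t h i]; [exact: h|exact: (h i)].
apply: fin_bigcap_measurable => // i _.
rewrite -[X in measurable X]setTI; apply: measurable_tnth => //.
exact: measurable_slab.
Qed.

Lemma measurable_bad_cover : measurable bad_cover.
Proof. by apply: fin_bigcup_measurable => // x _; exact: measurable_cover_box. Qed.

(** Once the [u_i] and the common [g] are fixed, the conditions on the [theta_i] are separate, so a
    box has measure at most the [s]-th power of the slab bound; the other factor counts the
    boxes. *)
Lemma bad_cover_measure_le (C D : R) : 0 <= C -> 0 < psi -> 2 * psi <= D ->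
  (forall (u : 'I_d -> int) a delta,
    (exists i, u i != 0) -> 0 < delta -> delta <= D ->
    (lebd (slab d u a delta N) <= (C * delta)%:E)%E) ->
  (lebesgue_measure_pow R s d bad_cover <=
    ((((Q + Q).+1 ^ (d * s) * K ^ d)%N)%:R * (C * (2 * psi)) ^+ s)%:E)%E.
Proof.
move=> C0 psi0 psiD slab_le.
have box_le x : (lebesgue_measure_pow R s d (cover_box x) <= ((C * (2 * psi)) ^+ s)%:E)%E.
  rewrite /cover_box; case: ifPn => [/forallP nz|_]; last first.
    by rewrite measure0 lee_fin exprn_ge0// !mulr_ge0// ltW.
  apply: (@le_trans _ _ (\prod_(i < s) lebd (cover_slab x i))%E).
    rewrite -(@power_measure_box _ _ _ lebd _ (cover_slab x))//.
    by move=> i; exact: measurable_slab.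
  apply: (@le_trans _ _ (\prod_(i < s) (C * (2 * psi))%R%:E)%E).
    (* Monotonicity of products requires nonnegative factors, so nonnegativity is carried through
       the induction. *)
    suff /andP[] : (0 <= \prod_(i < s) lebd (cover_slab x i)
        <= \prod_(i < s) (C * (2 * psi))%R%:E)%E by [].
    elim/big_ind2 : _ => [|x1 x2 y1 y2 /andP[? ?] /andP[? ?]|i _].
    - by rewrite lexx andbT.
    - by rewrite mule_ge0//= lee_pmul.
    - rewrite measure_ge0 /=; apply: slab_le => //; last by rewrite mulr_gt0.
      by have /existsP[j nzj] := nz i; exists j.
  by rewrite prodEFin prodr_const card_ord.
have := measure_bigcup_finType_le (lebesgue_measure_pow R s d)
  _ _ _ measurable_cover_box box_le.
by rewrite card_prod !card_ffun !card_ord -expnM.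
Qed.

Lemma dist_int_lt (x : R) : dist_int x < psi -> exists p : int, `|x - p%:~R| < psi.
Proof.
move=> /inf_lt[|y [p _ <-] ?]; last by exists p.
by exists `|x - 0%:~R|; exists 0.
Qed.

(** Write [xi] as an integer vector [q] plus [g / K] plus an error with entries below [1 / K]: [q]
    changes [u_i . xi] by an integer, the error by at most [d * Q / K <= psi]. The same [g] serves
    all [i]. *)
Lemma bad_coverP (Theta : s.-tuple (d.-tuple R)) (xi : d.-tuple R) :
  (0 < K)%N -> (d * Q)%:R <= K%:R * psi ->
  (forall i, cube d N (tnth Theta i)) ->
  (forall i, exists u : 'rV[int]_d, [/\ u != 0,
    `|map_mx intr u : 'rV[R]_d| <= Q%:R &
    dist_int (dot_int u (fun j => tnth xi j - tnth (tnth Theta i) j)) < psi]) ->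
  bad_cover Theta.
Proof.
move=> K0 Kpsi ThetaN /choice[u hu].
have KR0 : 0 < K%:R :> R by rewrite ltr0n.
have uQ i j : `|(u i ord0 j)%:~R| <= Q%:R :> R.
  have [_ + _] := hu i; apply: le_trans.
  rewrite [leRHS]mx_normrE.
  by have := le_bigmax 0 (fun ij => `|(map_mx intr (u i) : 'rV[R]_d) ij.1 ij.2|) (ord0, j);
    rewrite /= mxE.
have uQz i j : 0 <= u i ord0 j + Q%:Z /\ u i ord0 j + Q%:Z < (Q + Q).+1%:Z.
  have := uQ i j; rewrite ler_norml -[Q%:R]/(Q%:~R) -intrN !ler_int => /andP[? ?].
  by split; lia.
have uidx i j : (`|(u i ord0 j + Q%:Z)%R| < (Q + Q).+1)%N by have := uQz i j; lia.
pose us := [ffun i => [ffun j => Ordinal (uidx i j)]].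
have usE i j : shifted (us i j) = u i ord0 j.
  by rewrite /shifted !ffunE /=; have := uQz i j; lia.
(* Dividing the floor of [K * xi_j] by [K] separates the integer part [q] from the grid numerator
   [g]. *)
pose n j : int := Num.floor (K%:R * tnth xi j).
have gidx j : (`|(n j %% K%:Z)%Z| < K)%N.
  by have := @ltz_pmod (n j) K%:Z; have := @modz_ge0 (n j) K%:Z; lia.
pose g := [ffun j => Ordinal (gidx j)].
pose q j : int := (n j %/ K%:Z)%Z.
have gE j : n j = q j * K%:Z + (g j : nat)%:Z.
  rewrite ffunE /= gez0_abs ?modz_ge0//; last by lia.
  exact: divz_eq.
exists (us, g) => //; rewrite /cover_box ifT; last first.
  apply/forallP => i; apply/existsP.
  have [/rV0Pn[j nzj] _ _] := hu i; exists j.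
  by rewrite usE.
move=> i; split; first exact: ThetaN.
have [_ _ /dist_int_lt[p hp]] := hu i.
apply/near_intP => /=.
(* Since [u_i . (xi - theta_i)] is close to [p], [u_i . theta_i] is close to
   [u_i . g / K + u_i . q - p]. *)
exists (\sum_j u i ord0 j * q j - p).
under eq_bigr do rewrite usE.
under [X in _ - X - _]eq_bigr do rewrite usE.
have approx : `|\sum_j (u i ord0 j)%:~R * (tnth xi j - (g j)%:R / K%:R - (q j)%:~R)| <= psi.
  apply: (@le_trans _ _ (\sum_(j < d) Q%:R / K%:R)).
    apply: le_trans (ler_norm_sum _ _ _) _; apply: ler_sum => j _.
    rewrite normrM; apply: ler_pM => //.
    have := floor_itv (K%:R * tnth xi j); rewrite -/(n j) gE !intrD intrM.
    rewrite -!pmulrn => h.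
    rewrite -(ler_pM2l KR0) mulfV ?gt_eqF// -[X in X * _]gtr0_norm// -normrM.
    rewrite !mulrBr [X in _ - X - _]mulrC divfK ?gt_eqF// ler_norml; lra.
  rewrite sumr_const card_ord -[leLHS]mulr_natr mulrAC ler_pdivrMr//.
  by rewrite -natrM mulnC [leRHS]mulrC.
pose v j : R := (u i ord0 j)%:~R.
have vB (f h : 'I_d -> R) :
    \sum_j v j * (f j - h j) = \sum_j v j * f j - \sum_j v j * h j.
  by rewrite -sumrB; apply: eq_bigr => j _; rewrite mulrBr.
move: hp approx; rewrite /dot_int (vB (tnth xi)) (vB _ (fun j => (q j)%:~R)) (vB (tnth xi)).
have -> : (\sum_j u i ord0 j * q j - p)%:~R = \sum_j v j * (q j)%:~R - p%:~R :> R.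
  by rewrite intrB rmorph_sum /=; congr (_ - _); apply: eq_bigr => j _; rewrite intrM.
rewrite !ltr_norml !ler_norml; lra.
Qed.

End cover.

(** * Doubling, positivity, and the passage from dyadic scales to all [T] *)

Section type_function.
Context {R : realType}.
Variable Phi : R -> R.
Hypothesis Phi_nincr : forall x y : R, 1 <= x -> x <= y -> Phi y <= Phi x.
Hypothesis Phi_liminf :
  (0 < limf_einf (fun T : R => (Phi (2 * T) / Phi T)%:E) (pinfty_nbhs R))%E.

Lemma doubling_constant : exists2 kappa : R, 0 < kappa &
  \forall T \near +oo, kappa <= Phi (2 * T) / Phi T.
Proof.
move: Phi_liminf; rewrite limf_einfE => /ereal_sup_gt[_ [A FA <-] infA].
have [kappa k0 kinf] : exists2 kappa : R, 0 < kappa &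
    (kappa%:E <= ereal_inf [set (Phi (2 * T) / Phi T)%:E | T in A])%E.
  move: infA; case: ereal_inf => [r| |]//; first by exists r.
  by move=> _; exists 1 => //; rewrite leey.
exists kappa => //; apply: filterS FA => T AT.
by rewrite -lee_fin; apply: le_trans kinf _; apply: ereal_inf_lbound; exists T.
Qed.

Hypothesis Phi_cvg0 : Phi x @[x --> +oo] --> (0 : R).

(** Monotone decay to zero gives nonnegativity. A zero at a large [z] would contradict doubling,
    since [Phi (2 * z) / 0] is [0] by convention; monotonicity carries positivity back to [x]. *)
Lemma Phi_gt0 x : 1 <= x -> 0 < Phi x.
Proof.
have Phi_ge0 y : 1 <= y -> 0 <= Phi y.
  move=> y1; rewrite leNgt; apply/negP => Phiy.
  have Py : 0 < - Phi y by lra.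
  have [z [/= yz]] := filter_ex (filterI (nbhs_pinfty_ge (num_real y))
    (cvgr0_norm_lt _ Phi_cvg0 _ Py)).
  by have := Phi_nincr _ _ y1 yz; rewrite ltr_norml; lra.
move=> x1; have [kappa k0 Hk] := doubling_constant.
have [z [/= xz hz]] := filter_ex (filterI (nbhs_pinfty_ge (num_real x)) Hk).
apply: lt_le_trans (Phi_nincr _ _ x1 xz).
rewrite lt_neqAle Phi_ge0 ?(le_trans x1)// andbT eq_sym; apply/eqP => z0.
by move: hz; rewrite z0 invr0 mulr0; lra.
Qed.

(** For [2 ^ k <= T <= 2 ^ k.+1] the condition at scale [2 ^ k.+1] suffices, as doubling and
    monotonicity give [kappa * Phi T <= Phi (2 ^ k.+1)]. All small [T] are handled by one scale, at
    the price of a smaller [c]. *)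
Lemma UDT_of_dyadic s d (Theta : s.-tuple (d.-tuple R)) n :
  (forall m xi, (n <= m)%N -> exists i : 'I_s, forall u : 'rV[int]_d, u != 0 ->
    `|map_mx intr u : 'rV[R]_d| <= 2 ^+ m ->
    Phi (2 ^+ m) <= dist_int (dot_int u (fun j => tnth xi j - tnth (tnth Theta i) j))) ->
  exists c : R, 0 < c /\ UDT s d (fun T => c * Phi T) Theta.
Proof.
move=> good; have [kappa k0 [A [Areal Ak]]] := doubling_constant.
have lt_expn2 x : x < 2 ^+ (Num.truncn x).+1 :> R.
  apply: lt_trans (truncnS_gt x) _.
  by rewrite -natrX ltr_nat ltn_expl.
have e1 m : 1 <= 2 ^+ m :> R by rewrite exprn_ege1// ler1n.
pose m1 := maxn n (Num.truncn A).+1.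
have Am1 m : (m1 <= m)%N -> A < 2 ^+ m.
  move=> m1m; apply: lt_le_trans (lt_expn2 A) _.
  by rewrite ler_weXn2l ?ler1n// (leq_trans _ m1m)// leq_maxr.
have P1 := Phi_gt0 1 (lexx _).
have Pm1 := Phi_gt0 _ (e1 m1).
(* [kappa] serves [T > 2 ^ m1]; the ratio serves [T <= 2 ^ m1], where [Phi T <= Phi 1]. *)
exists (Num.min kappa (Phi (2 ^+ m1) / Phi 1)).
split; first by rewrite lt_min k0 divr_gt0.
set c := Num.min _ _.
have ck : c <= kappa by rewrite ge_min lexx.
have c1 : c * Phi 1 <= Phi (2 ^+ m1).
  by rewrite -ler_pdivlMr// ge_min lexx orbT.
have c0 : 0 < c by rewrite lt_min k0 divr_gt0.
move=> T xi T1; have [Tm1|Tm1] := leP T (2 ^+ m1).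
  have [|i hi] := good m1 xi; first exact: leq_maxl.
  exists i => u u0 uT; apply: le_trans (hi u u0 (le_trans uT Tm1)).
  by apply: le_trans c1; rewrite ler_pM2l// Phi_nincr.
have exk : exists k, T <= 2 ^+ k by exists (Num.truncn T).+1; exact/ltW.
case: (ex_minnP exk) => k Tk kmin.
have m1k : (m1 < k)%N.
  by rewrite -(ltr_eXn2l (_ : 1 < 2 :> R)) ?ltr1n// (lt_le_trans Tm1).
case: k m1k Tk kmin => // k m1k Tk kmin.
have kT : 2 ^+ k <= T.
  by rewrite leNgt; apply/negP => /ltW /kmin; rewrite ltnn.
have [|i hi] := good k.+1 xi.
  by rewrite (leq_trans (leq_maxl n _) (ltnW m1k)).
exists i => u u0 uT; apply: le_trans (hi u u0 (le_trans uT Tk)).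
rewrite exprS; have := Ak _ (Am1 k m1k).
rewrite ler_pdivlMr ?Phi_gt0//; apply: le_trans.
apply: ler_pM => //; [exact: ltW|by rewrite ltW// Phi_gt0|exact: Phi_nincr].
Qed.

End type_function.

(** * Counting at one scale, and Borel-Cantelli *)

Lemma dyadic_count_le (R : realType) (d s m K : nat) (C M psi : R) :
  0 <= C -> 0 < psi -> (d <= s)%N -> K%:R <= 2 * d%:R * M * 2 ^+ m / psi ->
  (((2 ^ m + 2 ^ m).+1 ^ (d * s) * K ^ d)%N)%:R * (C * (2 * psi)) ^+ s <=
  3 ^+ (d * s) * (2 * d%:R * M) ^+ d * (2 * C) ^+ s *
    (2 ^+ (m * d * (s + 1)) * psi ^+ (s - d)).
Proof.
move=> C0 psi0 ds hK.
have e0 : 0 < 2 ^+ m :> R by rewrite exprn_gt0.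
have -> : C * (2 * psi) = (2 * C) * psi by lra.
rewrite natrM !natrX [((2 * C) * psi) ^+ s]exprMn.
have h1 : (2 ^ m + 2 ^ m).+1%:R <= 3 * 2 ^+ m :> R.
  rewrite -natr1 natrD natrX.
  have : 1 <= 2 ^+ m :> R by rewrite exprn_ege1// ler1n.
  lra.
(* [d] of the [s] factors [psi] cancel against [K ^ d], as [K * psi] is at most a constant times
   [2 ^ m]; hence the exponent [s - d]. *)
have h2 : K%:R ^+ d * psi ^+ s <= (2 * d%:R * M) ^+ d * (2 ^+ m) ^+ d * psi ^+ (s - d).
  rewrite -[in leLHS](subnK ds) exprD [X in _ * X <= _]mulrC mulrA -!exprMn.
  apply: ler_wpM2r; first by rewrite exprn_ge0// ltW.
  rewrite lerXn2r ?nnegrE//.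
  - by rewrite mulr_ge0// ltW.
  - by move: (le_trans (ler0n R K) hK); rewrite pmulr_lge0 ?invr_gt0.
  - by rewrite -ler_pdivlMr.
have -> : 2 ^+ (m * d * (s + 1)) = (2 ^+ m) ^+ (d * s) * (2 ^+ m) ^+ d :> R.
  by rewrite -!exprM -exprD -mulnDr -mulnA mulnDr muln1.
have h3 : (2 ^ m + 2 ^ m).+1%:R ^+ (d * s) <= 3 ^+ (d * s) * (2 ^+ m) ^+ (d * s) :> R.
  by rewrite -exprMn lerXn2r ?nnegrE// mulr_ge0// ltW.
have C2 : 0 <= (2 * C) ^+ s by rewrite exprn_ge0// mulr_ge0.
rewrite [leLHS](_ : _ = (2 * C) ^+ s *
  ((2 ^ m + 2 ^ m).+1%:R ^+ (d * s) * (K%:R ^+ d * psi ^+ s))); last by lra.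
rewrite [leRHS](_ : _ = (2 * C) ^+ s * ((3 ^+ (d * s) * (2 ^+ m) ^+ (d * s)) *
  ((2 * d%:R * M) ^+ d * (2 ^+ m) ^+ d * psi ^+ (s - d)))); last by lra.
apply: ler_wpM2l => //; apply: ler_pM => //.
by rewrite mulr_ge0 ?exprn_ge0// ltW.
Qed.

Theorem theorem5p3 (R : realType) (d s : nat) (Phi : R -> R)
  (hd : (1 <= d)%N) (hs : (d + 1 <= s)%N)
  (Phi_nincr : forall x y : R, 1 <= x -> x <= y -> Phi y <= Phi x)
  (Phi_cvg0 : Phi x @[x --> +oo] --> (0 : R))
  (Phi_liminf :
    (0 < limf_einf (fun T : R => (Phi (2 * T) / Phi T)%:E) (pinfty_nbhs R))%E)
  (Phi_sum :
    (\sum_(1 <= m <oo)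
       (2 ^+ (m * d * (s + 1)) * Phi (2 ^+ m) ^+ (s - d))%:E < +oo)%E) :
  {ae (lebesgue_measure_pow R s d), forall Theta : s.-tuple (d.-tuple R),
    exists c : R, 0 < c /\ UDT s d (fun T => c * Phi T) Theta}.
Proof.
have Pgt0 := @Phi_gt0 _ _ Phi_nincr Phi_liminf Phi_cvg0.
have e1 m : 1 <= 2 ^+ m :> R by rewrite exprn_ege1// ler1n.
have psi0 m : 0 < Phi (2 ^+ m) by exact: Pgt0.
(* [M >= 1] makes the grid fine enough ([K_ge]); [M >= Phi (2 ^+ m)] gives [r m >= 1], so rounding
   up in [K] at most doubles [r m] ([K_le]). *)
pose M := Num.max 1 (Phi 1).
have psiM m : Phi (2 ^+ m) <= M.
  by apply: le_trans (Phi_nincr _ _ (lexx _) (e1 m)) _; rewrite le_max lexx orbT.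
have M1 : 1 <= M by rewrite le_max lexx.
pose r m := d%:R * M * 2 ^+ m / Phi (2 ^+ m).
pose K m := (Num.truncn (r m)).+1.
have d1 : 1 <= d%:R :> R by rewrite ler1n.
have r1 m : 1 <= r m.
  rewrite ler_pdivlMr// mul1r; apply: le_trans (psiM m) _.
  by rewrite -mulrA mulrCA ler_peMr ?(mulr_ege1)//; lra.
have K_ge m : (d * 2 ^ m)%:R <= (K m)%:R * Phi (2 ^+ m).
  rewrite -ler_pdivrMr//; apply: le_trans (ltW (truncnS_gt (r m))).
  by rewrite /r natrM natrX ler_pM2r ?invr_gt0// mulrAC ler_peMr.
have K_le m : (K m)%:R <= 2 * d%:R * M * 2 ^+ m / Phi (2 ^+ m).
  have -> : 2 * d%:R * M * 2 ^+ m / Phi (2 ^+ m) = r m + r m by rewrite /r; lra.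
  rewrite /K -natr1; apply: lerD => //.
  by rewrite truncn_le (le_trans _ (r1 m)).
pose V (n m : nat) := bad_cover s d (2 ^ m) (K m) n%:R (Phi (2 ^+ m)).
(* The union exhausts the space of [Theta] by cubes of half-width [n]; [m.+1] matches the series,
   which starts at 1. *)
apply: (@negligibleS _ _ _ _ (\bigcup_n lim_sup_set (fun m => V n m.+1))).
  move=> Theta notUDT.
  pose b := \big[Num.max/0]_(ij : 'I_s * 'I_d) `|tnth (tnth Theta ij.1) ij.2|.
  (* This half-width exceeds every [|theta_ij|]. If [Theta] avoids the bad sets of all scales from
     [n.+1] on, the dyadic criterion applies. *)
  exists (Num.truncn b).+1 => // n _; apply: contrapT => ThetaV; apply: notUDT.
  apply: (@UDT_of_dyadic _ _ Phi_nincr Phi_liminf Phi_cvg0 _ _ _ n.+1) => -[//|m] xi nm.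
  apply: contrapT => /forallNP bad; apply: ThetaV; exists m => //=.
  apply: (@bad_coverP _ _ _ _ _ _ _ _ xi) => //.
    move=> i j /=; rewrite in_itv /= -ler_norml.
    apply: le_trans (ltW (truncnS_gt b)).
    exact: (le_bigmax 0 (fun ij => `|tnth (tnth Theta ij.1) ij.2|) (i, j)).
  move=> i; have /existsNP[u /not_implyP[u0 /not_implyP[uT /negP]]] := bad i.
  rewrite -ltNge => du; exists u; split => //.
  by rewrite natrX.
apply: negligible_bigcup => n.
(* [2 * M] is above every half-width [2 * psi], so one [C] serves all scales. *)
have [C C0 slab_le] := slab_measure_le d n%:R (2 * M) (ler0n _ n) ltac:(lra).
have mV m : measurable (V n m) by exact: measurable_bad_cover.
exists (lim_sup_set (fun m => V n m.+1)); split => //.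
  by apply: bigcapT_measurable => k; apply: bigcup_measurable => j _; exact: mV.
(* By Borel-Cantelli it remains to show that the measures of the covers are summable. *)
apply: lim_sup_set_cvg0 => //.
pose C' := 3 ^+ (d * s) * (2 * d%:R * M) ^+ d * (2 * C) ^+ s.
pose a m := (2 ^+ (m * d * (s + 1)) * Phi (2 ^+ m) ^+ (s - d))%:E.
have a0 m : (0 <= a m)%E.
  by rewrite lee_fin mulr_ge0// exprn_ge0// ltW.
apply: (@le_lt_trans _ _ (\sum_(0 <= m <oo) (C'%:E * a (m + 1)%N))%E).
  apply: lee_nneseries => [m _ _|m _].
    exact: measure_ge0.
  rewrite addn1 -EFinM.
  apply: le_trans (bad_cover_measure_le _ _ _ _ _ _ C (2 * M) C0 (psi0 _) _ slab_le) _.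
    by rewrite ler_pM2l.
  rewrite lee_fin; apply: dyadic_count_le => //.
  by rewrite (leq_trans _ hs)// leq_addr.
rewrite nneseriesZl// (nneseries_addn 1%N)//.
by rewrite lte_mul_pinfty// ?lee_fin ?ge0_fin_numE// !mulr_ge0 ?exprn_ge0// !mulr_ge0//; lra.
Qed.
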